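(* Let $c,d\in\mathbb{Z}$ be such that $g(x)=x^5+cx^4+d$ is irreducible in $\mathbb{Z}[x]$, and let $\theta$ be a root of $g$. Suppose that $\dfrac{5^5d+2^8c^5}{\gcd(5^5d,\,2^8c^5)}$ is square-free. Then $\mathbb{Z}[\theta]$ is the full ring of integers of $\mathbb{Q}(\theta)$ if and only if $d$ is square-free and, in the case $5\mid c$ and $5\nmid d$, $c+d\not\equiv 1,7,18,24\pmod{25}$. *)

(* Defs.v *)
From HB Require Import structures.
From mathcomp Require Import all_boot all_order all_algebra all_field.
Set Implicit Arguments. Unset Strict Implicit. Unset Printing Implicit Defensive.
Import Order.TTheory GRing.Theory Num.Theory.
Local Open Scope ring_scope.

Definition gpoly (c d : int) : {poly int} := 'X^5 + c%:P * 'X^4 + d%:P.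

Definition irreducible_Zx (p : {poly int}) : Prop :=
  p != 0 /\ p \isn't a GRing.unit /\
  forall a b : {poly int}, p = a * b -> a \is a GRing.unit \/ b \is a GRing.unit.

Definition squarefree_int (n : int) : Prop :=
  forall m : int, (m * m %| n)%Z -> `|m| = 1.

Definition Zadj (theta : algC) : algC -> Prop :=
  fun a => exists p : {poly int}, a = (map_poly intr p).[theta].

Definition Qadj (theta : algC) : algC -> Prop :=
  fun a => exists p : {poly rat}, a = (map_poly ratr p).[theta].

Definition ring_of_integers (theta : algC) : algC -> Prop :=
  fun a => Qadj theta a /\ a \in Aint.

(* Main.v *)
(** An integral element of Q(theta) outside Z[theta] has a multiple f(theta)/p
    with p prime and f outside the ideal (p, g) of Z[x]. As the ring of integers
    lies in the inverse different, f g' is in (p, g), and g' = x^3 (5 x + 4 c) is,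
    up to a unit modulo p, a product of linear factors x - r (when p = 5 divides c,
    g' vanishes modulo p, and g itself, a fifth power modulo 5, plays this role).
    Peeling off these factors one by one shows that some g1(theta)/p is integral,
    where g1 = (g - g(r)) / (x - r) and p divides g(r); its norm is
    g(r)^4 / p^5 up to sign, so p^2 divides g(r). For r = 0 this says p^2 | d, for
    r = - 4 c / 5 it contradicts the hypothesis on 5^5 d + 2^8 c^5, and for r = - d,
    p = 5 it is the condition on c + d modulo 25. Conversely, g1(theta)/m is
    integral as soon as m divides g'(r) and m^2 divides g(r). *)
Require Import Defs.
From HB Require Import structures.
From mathcomp Require Import all_boot all_order all_algebra all_field.
From mathcomp Require Import ring zify.
Import Order.TTheory GRing.Theory Num.Theory.
Local Open Scope ring_scope.

(** * Integer polynomials and their values at algebraic integers *)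

Local Notation ZtoC := (map_poly (intr : int -> algC)).
Local Notation ZtoQ := (map_poly (intr : int -> rat)).
Local Notation QtoC := (map_poly (ratr : rat -> algC)).

Lemma QtoC_ZtoQ (f : {poly int}) : QtoC (ZtoQ f) = ZtoC f.
Proof. by rewrite -map_poly_comp; apply: eq_map_poly => x /=; rewrite ratr_int. Qed.

Lemma size_ZtoC (f : {poly int}) : size (ZtoC f) = size f.
Proof. by rewrite size_map_inj_poly //; exact: intr_inj. Qed.

Lemma ZtoC_int (f : {poly int}) : ZtoC f \is a polyOver Num.int.
Proof. by apply/polyOverP=> i; rewrite coef_map /= intr_int. Qed.

Lemma rat_Aint_div (a m : int) :
  m != 0 -> (a%:~R / m%:~R : algC) \in Aint -> exists b : int, a = m * b.
Proof.
move=> m0 aA.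
have /intrP[b bE] : (a%:~R / m%:~R : algC) \is a Num.int.
  by apply: Cint_rat_Aint aA; rewrite rpred_div ?rpred_int.
exists b; apply: (@intr_inj algC).
by rewrite intrM -bE mulrC divfK // intr_eq0.
Qed.

Lemma horner_ZtoC_Aint (f : {poly int}) (x : algC) :
  x \in Aint -> (ZtoC f).[x] \in Aint.
Proof.
move=> xA; rewrite rpred_horner //.
by apply/polyOverP=> i; rewrite coef_map Aint_int.
Qed.

(** Evaluation at [r] gives [p * m.[r] = 0], so X - r divides [m] and cancels: it is regular modulo
    [p]. *)
Lemma eq_mulXsubC_mulC (a m : {poly int}) (p r : int) :
  p != 0 -> a * ('X - r%:P) = p%:P * m -> exists b, a = p%:P * b.
Proof.
move=> p0 am; have /factor_theorem[b mE] : root m r.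
  have := congr1 (horner^~ r) am.
  rewrite !hornerM hornerXsubC subrr mulr0 hornerC => /esym/eqP.
  by rewrite mulf_eq0 (negPf p0).
exists b; apply: (mulIf (negbT (polyXsubC_eq0 r))).
by rewrite am mE mulrA.
Qed.

Lemma poly_taylor1 (k : {poly int}) (r : int) :
  exists k1, k = k1 * ('X - r%:P) + k.[r]%:P.
Proof.
have /factor_theorem[k1 kE] : root (k - k.[r]%:P) r.
  by rewrite /root hornerD hornerN hornerC subrr.
by exists k1; rewrite -kE subrK.
Qed.

(** At a root x of [g], membership gives f(x)/p = h(x), an element of Z[x]. *)
Definition in_ideal (p : int) (g f : {poly int}) : Prop :=
  exists k h, f = k * g + p%:P * h.

(** * Monic irreducible polynomials: conjugates, inverse different, norms, denominators *)

Section Dedekind.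

Variable g : {poly int}.
Hypotheses (gM : g \is monic) (gI : irreducible_Zx g).

Lemma root_monicZ_Aint (x : algC) : root (ZtoC g) x -> x \in Aint.
Proof. by move=> gx; apply: root_monic_Aint gx _ (ZtoC_int g); exact: monic_map. Qed.

(** As [z] is integral, its minimal polynomial has integer coefficients and divides [g] in Z[X];
    irreducibility there makes the two equal. *)
Lemma root_irreducible_dvdp (z : algC) (q : {poly rat}) :
  root (ZtoC g) z -> root (QtoC q) z = (ZtoQ g %| q).
Proof.
move=> gz.
have zA := root_monicZ_Aint z gz.
have [m [mE mM] mP] := minCpolyP z; rewrite mP.
have [m' m'E] := floorpP zA.
have m'Q : m = ZtoQ m'.
  by apply: (map_poly_inj (ratr : {rmorphism rat -> algC})); rewrite QtoC_ZtoQ -m'E.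
have m'M : m' \is monic.
  rewrite monicE -(inj_eq (@intr_inj algC)) -lead_coef_map_inj //; last exact: intr_inj.
  by rewrite -m'E -monicE minCpoly_monic.
have : m %| ZtoQ g by rewrite -mP QtoC_ZtoQ.
rewrite m'Q dvdp_rat_int => /(Pdiv.IdomainMonic.dvdpP m'M)[k gE].
have [_ [_ /(_ _ _ gE)[]]] := gI.
  rewrite poly_unitE => /andP[/size_poly1P[a a0 kE] _].
  have := monicMr k m'M; rewrite -gE gM kE => /esym; rewrite monicE lead_coefC => /eqP a1.
  by rewrite gE kE a1 mul1r.
rewrite poly_unitE => /andP[/eqP s1 _].
by have := size_minCpoly z; rewrite m'E size_ZtoC s1.
Qed.

Lemma root_irreducible_dvdpZ (z : algC) (u : {poly int}) :
  root (ZtoC g) z -> root (ZtoC u) z -> exists k, u = k * g.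
Proof.
move=> gz; rewrite -QtoC_ZtoQ (root_irreducible_dvdp _ _ gz) dvdp_rat_int.
by move/(Pdiv.IdomainMonic.dvdpP gM).
Qed.

(** If [m] is the minimal polynomial of q(x), then [g] divides the composite m(q(X)), which
    therefore vanishes at [z] too. *)
Lemma conjugate_Aint (x z : algC) (q : {poly rat}) :
  root (ZtoC g) x -> root (ZtoC g) z ->
  (QtoC q).[x] \in Aint -> (QtoC q).[z] \in Aint.
Proof.
move=> gx gz qA; have [m mE] := floorpP qA.
have mM : ZtoC m \is monic by rewrite -mE minCpoly_monic.
have mq0 y : root (ZtoC m) (QtoC q).[y] = root (QtoC (ZtoQ m \Po q)) y.
  by rewrite map_comp_poly QtoC_ZtoQ /root horner_comp.
apply: (@root_monic_Aint (ZtoC m)) => //; last exact: ZtoC_int.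
rewrite mq0 (root_irreducible_dvdp _ _ gz) -(root_irreducible_dvdp _ _ gx) -mq0.
by rewrite -mE root_minCpoly.
Qed.

Lemma conjugate_Aint_div (x z : algC) (f : {poly int}) (n : int) :
  root (ZtoC g) x -> root (ZtoC g) z ->
  (ZtoC f).[x] / n%:~R \in Aint -> (ZtoC f).[z] / n%:~R \in Aint.
Proof.
move=> gx gz; have E y : (ZtoC f).[y] / n%:~R = (QtoC (n%:~R^-1 *: ZtoQ f)).[y].
  by rewrite map_polyZ /= hornerZ QtoC_ZtoQ mulrC [ratr _]fmorphV /= ratr_int.
by rewrite !E; exact: conjugate_Aint.
Qed.

(** A multiple root would be a root of the derivative, so [g] would divide a nonzero polynomial of
    smaller degree. *)
Lemma irreducible_roots :
  {rs : seq algC | uniq rs & ZtoC g = \prod_(z <- rs) ('X - z%:P)}.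
Proof.
have [rs gE] := closed_field_poly_normal (ZtoC g).
have gCM : ZtoC g \is monic by exact: monic_map.
rewrite (monicP gCM) scale1r in gE; exists rs => //.
rewrite -separable_prod_XsubC -gE unlock; apply/Pdiv.ClosedField.coprimepP=> z gz.
apply/negP; rewrite deriv_map -/(root _ _) => /(root_irreducible_dvdpZ _ _ gz)[k g'E].
have g0 : g != 0 by exact: monic_neq0.
have lt := lt_size_deriv g0.
have [k0|k0] := eqVneq k 0; last first.
  move: lt; rewrite g'E size_Mmonic //; have := size_poly_gt0 k; rewrite k0; lia.
have : size (ZtoC g) != 1%N by apply/eqP=> /eqP/size_poly1P[a a0 E]; move: gz; rewrite E rootC (negPf a0).
rewrite size_ZtoC => s1.
have s2 : (1 < size g)%N by have := size_poly_gt0 g; rewrite g0; lia.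
have : (g^`())`_((size g).-2) = (size g).-1%:R.
  by rewrite coef_deriv prednK ?(eqP gM) //; [rewrite -/(lead_coef g) (monicP gM)|lia].
by rewrite g'E k0 mul0r coef0 => /eqP; rewrite eq_sym pnatr_eq0; lia.
Qed.

(* The Lagrange interpolation formula for [f * g'] at the roots of [g] has
   algebraic integer coefficients after division by [p]: this is the inclusion
   of the ring of integers in the inverse different of [Z[x]]. *)
Lemma Aint_div_mul_deriv (x : algC) (p : int) (f : {poly int}) :
  p != 0 -> root (ZtoC g) x -> (ZtoC f).[x] / p%:~R \in Aint ->
  in_ideal p g (f * g^`()).
Proof.
move=> p0 gx fA; have [rs rsU gE] := irreducible_roots.
have fzA z : z \in rs -> (ZtoC f).[z] / p%:~R \in Aint.
  by rewrite -root_prod_XsubC -gE => gz; exact: conjugate_Aint_div gx gz fA.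
have pC0 : (p%:~R : algC) != 0 by rewrite intr_eq0.
pose H z : {poly algC} := \prod_(y <- rem z rs) ('X - y%:P).
have gH z : z \in rs -> ZtoC g = ('X - z%:P) * H z.
  by move=> zrs; rewrite gE (perm_big _ (perm_to_rem zrs)) big_cons.
pose P := \sum_(z <- rs) ((ZtoC f).[z] / p%:~R) *: H z.
have rsA : {subset rs <= Aint}.
  by move=> z zrs; rewrite root_monicZ_Aint // gE root_prod_XsubC.
have PA : P \is a polyOver Aint.
  rewrite /P big_seq rpred_sum // => z zrs; rewrite polyOverZ ?fzA //.
  rewrite /H big_seq rpred_prod // => y /mem_rem yrs.
  by rewrite polyOverXsubC; exact: rsA.
set R := Pdiv.CommonRing.rmodp (f * g^`()) g.
have RE := Pdiv.RingMonic.rdivp_eq gM (f * g^`()); rewrite -/R in RE.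
have sg : size g = (size rs).+1 by rewrite -size_ZtoC gE size_prod_XsubC.
have RP : ZtoC R = p%:~R *: P.
  (* Both sides have degree below the number of roots, so it suffices to compare them at each root
     z, where [H z] takes the value g'(z). *)
  apply/eqP; rewrite -subr_eq0; apply/eqP/(@roots_geq_poly_eq0 _ _ rs) => //.
    apply/allP=> z zrs; have gz : root (ZtoC g) z by rewrite gE root_prod_XsubC.
    have g'z : (ZtoC g^`()).[z] = (H z).[z].
      rewrite -deriv_map (gH z zrs) derivM derivXsubC mul1r hornerD hornerM.
      by rewrite hornerXsubC subrr mul0r addr0.
    have Pz : P.[z] = (ZtoC f).[z] / p%:~R * (H z).[z].
      rewrite /P horner_sum (perm_big _ (perm_to_rem zrs)) big_cons /= hornerZ.
      rewrite big1_seq ?addr0 // => y /andP[_ yrs]; rewrite hornerZ.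
      have zy : z != y by apply: contraTneq yrs => <-; rewrite mem_rem_uniq // !inE eqxx.
      suff /eqP-> : (H y).[z] == 0 by rewrite mulr0.
      by rewrite -/(root _ _) root_prod_XsubC mem_rem_uniq // !inE zy zrs.
    have := congr1 (fun h => (ZtoC h).[z]) RE.
    rewrite rmorphD !rmorphM /= hornerD !hornerM g'z (rootP gz) mulr0 add0r => fR.
    by rewrite /root hornerD hornerN hornerZ -fR Pz; apply/eqP; field.
  rewrite (leq_trans (size_polyD _ _)) // size_polyN geq_max size_ZtoC.
  rewrite -ltnS -sg Pdiv.CommonRing.ltn_rmodpN0 ?monic_neq0 //=.
  rewrite (leq_trans (size_scale_leq _ _)) // (leq_trans (size_sum _ _ _)) //.
  apply/bigmax_leqP_seq=> z zrs _; rewrite (leq_trans (size_scale_leq _ _)) //.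
  by rewrite /H size_prod_XsubC size_rem // prednK //; case: (rs) zrs.
have pR i : exists b, R`_i = p * b.
  apply: rat_Aint_div => //; have /(congr1 (fun h : {poly algC} => h`_i)) := RP.
  by rewrite coef_map coefZ /= => ->; rewrite mulrC mulKf //; exact: (polyOverP PA).
exists (Pdiv.CommonRing.rdivp (f * g^`()) g), (\poly_(i < size R) (R`_i %/ p)%Z).
rewrite {1}RE; congr (_ + _); apply/polyP=> i; rewrite coefCM coef_poly.
case: ltnP => [_|/leq_sizeP-> //]; last by rewrite mulr0.
by have [b ->] := pR i; rewrite mulKz.
Qed.

(* Taking norms: the conjugates of [g1(x) / p] multiply to [(g(r) / p)^n / g(r)]. *)
Lemma simple_root_not_Aint (x : algC) (p : nat) (r : int) (g1 : {poly int}) :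
  prime p -> root (ZtoC g) x -> g = g1 * ('X - r%:P) + g.[r]%:P ->
  (p %| g.[r])%Z -> ~~ (p%:Z ^+ 2 %| g.[r])%Z ->
  (ZtoC g1).[x] / p%:~R \notin Aint.
Proof.
move=> pP gx gE /dvdzP[e eE] /negP p2; apply/negP=> g1A.
have [rs rsU gP] := irreducible_roots.
have pC0 : (p%:~R : algC) != 0 by rewrite intr_eq0; lia.
have e0 : e != 0 by apply: contra_notN p2 => /eqP e0; rewrite eE e0 mul0r dvdz0.
have eC0 : (e%:~R : algC) != 0 by rewrite intr_eq0.
pose b z := (ZtoC g1).[z] / p%:~R.
have bA : \prod_(z <- rs) b z \in Aint.
  rewrite big_seq rpred_prod // => z zrs.
  by apply: conjugate_Aint_div gx _ g1A; rewrite gP root_prod_XsubC.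
have bz z : z \in rs -> b z * (r%:~R - z) = e%:~R.
  move=> zrs; have gz : root (ZtoC g) z by rewrite gP root_prod_XsubC.
  have := rootP gz; rewrite {1}gE rmorphD rmorphM rmorphB /= map_polyX !map_polyC /=.
  rewrite hornerD hornerM hornerXsubC hornerC eE intrM /b => H.
  apply: (mulIf pC0); have -> : e%:~R * p%:~R = - ((ZtoC g1).[z] * (z - r%:~R)).
    by apply/eqP; rewrite -addr_eq0 addrC H.
  by field.
have gr : \prod_(z <- rs) (r%:~R - z) = (e * p)%:~R :> algC.
  rewrite -eE -(horner_map (intr : {rmorphism int -> algC})) gP horner_prod.
  by apply: eq_bigr => z _; rewrite hornerXsubC.
have : \prod_(z <- rs) (b z * (r%:~R - z)) = e%:~R ^+ size rs.
  by rewrite (eq_big_seq _ bz) big_const_seq count_predT iter_mulr_1.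
rewrite big_split gr /=.
have rs0 : (0 < size rs)%N by case: (rs) gP gx => // ->; rewrite big_nil rootC oner_eq0.
rewrite -(prednK rs0) exprSr intrM => H.
(* With g(r) = e p and n roots, the product of the [b z] is e^(n-1)/p; its integrality forces p to
   divide e, hence p^2 to divide g(r). *)
have : (e ^+ (size rs).-1)%:~R / p%:~R \in Aint.
  suff -> : (e ^+ (size rs).-1)%:~R / p%:~R = \prod_(z <- rs) b z by [].
  apply: (mulIf pC0); rewrite divfK // rmorphXn; apply: (mulIf eC0); rewrite -H; ring.
have pz : p%:Z != 0 by lia.
move/(rat_Aint_div _ _ pz)=> [k ekE].
have : (p %| e ^+ (size rs).-1)%Z by rewrite ekE dvdz_mulr.
rewrite dvdzE abszX /= Euclid_dvdX // => /andP[pe _].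
by apply: p2; rewrite eE dvdz_mul // dvdzE.
Qed.

Lemma in_ideal_div_XsubC (x : algC) (p : nat) (r : int) (f : {poly int}) :
  prime p -> root (ZtoC g) x ->
  ((p %| g.[r])%Z -> ~~ (p%:Z ^+ 2 %| g.[r])%Z) ->
  (ZtoC f).[x] / p%:~R \in Aint ->
  in_ideal p g (f * ('X - r%:P)) -> in_ideal p g f.
Proof.
move=> pP gx gr fA [k [h fE]].
have pz : p%:Z != 0 by rewrite eqz_nat -lt0n prime_gt0.
have [g1 gE] := poly_taylor1 g r; have [k1 kE] := poly_taylor1 k r.
(* If p divides k(r), then k is a multiple of X - r modulo p, and X - r cancels. Otherwise k(r) is
   invertible modulo p, and evaluation at [r] shows that p divides g(r). *)
have [/dvdzP[c kr]|pk] := boolP (p %| k.[r])%Z.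
  have [|b bE] := @eq_mulXsubC_mulC (f - k1 * g) (c%:P * g + h) p r pz.
    by rewrite mulrBl fE {1}kE kr; ring.
  by exists k1, b; rewrite -bE; ring.
have kp : coprimez p k.[r] by rewrite coprimezE /= prime_coprime.
have pg : (p %| g.[r])%Z.
  rewrite -(Gauss_dvdzr _ kp).
  have := congr1 (horner^~ r) fE.
  rewrite hornerD !hornerM hornerXsubC subrr mulr0 hornerC => /esym/eqP.
  by rewrite addr_eq0 => /eqP->; rewrite rpredN dvdz_mulr.
have /negP[] := simple_root_not_Aint x p r g1 pP gx gE pg (gr pg).
have /dvdzP[e eE] := pg.
have [|m mE] := @eq_mulXsubC_mulC (f - k * g1) (e%:P * k + h) p r pz.
  by rewrite mulrBl fE {1}gE eE; ring.
have [u [v]] := Bezoutz k.[r] p.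
rewrite gcdzC (eqP kp) => uv.
(* Modulo p, f = k g1 and g = g1 (X - r); since u inverts k(r), [g1] is u f modulo (p, g). Thus
   g1(x)/p would be integral along with f(x)/p. *)
have [w g1E] : exists w : {poly int}, g1 = u%:P * f + (- u%:P * k1) * g + p%:Z%:P * w.
  exists (u%:P * e%:P * k1 - u%:P * m + v%:P * g1).
  have -> : f = k * g1 + p%:Z%:P * m by rewrite -mE; ring.
  have uvP : u%:P * k.[r]%:P + v%:P * p%:Z%:P = 1 :> {poly int}.
    by rewrite -!polyCM -polyCD uv.
  have gE' : g = g1 * ('X - r%:P) + e%:P * p%:Z%:P by rewrite {1}gE eE polyCM.
  by rewrite {1}gE' {1}kE -{1}[g1]mul1r -uvP; ring.
have pC0 : (p%:~R : algC) != 0 by rewrite intr_eq0.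
suff -> : (ZtoC g1).[x] / p%:~R = u%:~R * ((ZtoC f).[x] / p%:~R) + (ZtoC w).[x].
  apply: rpredD; first exact: rpredM (Aint_int u) fA.
  exact/horner_ZtoC_Aint/root_monicZ_Aint.
rewrite g1E !rmorphD !rmorphM /= !hornerD !hornerM (rootP gx) mulr0 addr0.
by rewrite !map_polyC !hornerC /=; field.
Qed.

Lemma in_ideal_div_prod (x : algC) (p : nat) (rs : seq int) (f : {poly int}) :
  prime p -> root (ZtoC g) x ->
  (forall r, r \in rs -> (p %| g.[r])%Z -> ~~ (p%:Z ^+ 2 %| g.[r])%Z) ->
  (ZtoC f).[x] / p%:~R \in Aint ->
  in_ideal p g (f * \prod_(r <- rs) ('X - r%:P)) -> in_ideal p g f.
Proof.
move=> pP gx; elim: rs f => [|r rs IH] f gr fA; first by rewrite big_nil mulr1.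
rewrite big_cons mulrA => /IH fr; apply: (in_ideal_div_XsubC x p r) => //.
  by apply: gr; rewrite mem_head.
apply: fr => [s srs|]; first by apply: gr; rewrite inE srs orbT.
rewrite rmorphM hornerM mulrAC; apply: rpredM fA _.
exact/horner_ZtoC_Aint/root_monicZ_Aint.
Qed.

(* Descent on the denominator of an integral element. *)
Lemma Zadj_of_in_ideal (x : algC) :
  root (ZtoC g) x ->
  (forall (p : nat) (f : {poly int}), prime p ->
     (ZtoC f).[x] / p%:~R \in Aint -> in_ideal p g f) ->
  forall a, ring_of_integers x a -> Zadj x a.
Proof.
move=> gx HJ a [[q ->] aA].
have [f [m m0 qE]] := rat_poly_scale q.
have aE : (QtoC q).[x] = (ZtoC f).[x] / m%:~R.
  by rewrite qE map_polyZ /= hornerZ QtoC_ZtoQ mulrC [ratr _]fmorphV /= ratr_int.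
wlog m_gt0 : f m m0 qE aE / (0 < m).
  move=> W; have [m1|m1] := ltP 0 m; first exact: (W f m).
  apply: (W (- f) (- m)); rewrite ?oppr_eq0 ?rmorphN //=; last by lia.
    by rewrite qE scalerN invrN scaleNr opprK.
  by rewrite aE hornerN invrN mulrNN.
case: m m_gt0 aE {m0 qE} => // n; rewrite ltz_nat => n0 aE; rewrite aE in aA *.
elim/ltn_ind: n f n0 aA {aE} => n IH f n0 fA.
have [n1|n1] := leqP n 1.
  by exists f; have -> : n = 1%N by [lia]; rewrite divr1.
have pP := pdiv_prime n1; set p := pdiv n in pP.
have /dvdnP[n' nE] : (p %| n)%N := pdiv_dvd n.
have pC0 : (p%:~R : algC) != 0 by rewrite intr_eq0; lia.
have n'0 : (0 < n')%N by lia.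
have n'C0 : (n'%:~R : algC) != 0 by rewrite intr_eq0; lia.
have [|k [h fE]] := HJ p f pP.
  have -> : (ZtoC f).[x] / p%:~R = (ZtoC f).[x] / n%:~R * n'%:~R.
    by rewrite nE PoszM intrM; field; rewrite n'C0 pC0.
  by rewrite rpredM // Aint_int.
have E : (ZtoC f).[x] / n%:~R = (ZtoC h).[x] / n'%:~R.
  rewrite fE rmorphD !rmorphM /= hornerD !hornerM (rootP gx) mulr0 add0r.
  by rewrite map_polyC hornerC /= nE PoszM intrM; field; rewrite n'C0 pC0.
rewrite E; apply: IH => //; last by rewrite -E.
by rewrite nE ltn_Pmulr // prime_gt1.
Qed.

(** Reducing modulo [g] makes u = m R with R integral, as both sides have degree below that of [g];
    the leading coefficient 1 is then a multiple of [m]. *)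
Lemma Zadj_monic_div (x : algC) (m : int) (u : {poly int}) :
  root (ZtoC g) x -> m != 0 -> u \is monic -> (size u < size g)%N ->
  Zadj x ((ZtoC u).[x] / m%:~R) -> `|m| = 1.
Proof.
move=> gx m0 uM su [f fE].
pose R := Pdiv.CommonRing.rmodp f g.
have RE := Pdiv.RingMonic.rdivp_eq gM f; rewrite -/R in RE.
have sR : (size R < size g)%N by rewrite Pdiv.CommonRing.ltn_rmodpN0 ?monic_neq0.
have [k kE] : exists k, u - m%:P * R = k * g.
  apply: (root_irreducible_dvdpZ x) => //.
  rewrite /root rmorphB rmorphM /= hornerD hornerN hornerM map_polyC hornerC /= subr_eq0.
  have -> : (ZtoC R).[x] = (ZtoC f).[x].
    by rewrite [in RHS]RE rmorphD rmorphM /= hornerD hornerM (rootP gx) mulr0 add0r.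
  by rewrite -fE mulrC divfK // intr_eq0.
have k0 : k = 0.
  apply/eqP/negPn/negP=> k0.
  have : (size (k * g)%R < size g)%N.
    rewrite -kE (leq_ltn_trans (size_polyD _ _)) // size_polyN gtn_max su /=.
    by rewrite mul_polyC (leq_ltn_trans (size_scale_leq _ _)).
  rewrite size_Mmonic //; have := size_poly_gt0 k; rewrite k0; lia.
have := congr1 (fun v : {poly int} => v`_((size u).-1)) kE.
rewrite k0 mul0r coefB coefCM coef0 -/(lead_coef u) (monicP uM) => /eqP.
rewrite subr_eq0 => /eqP E.
have : (m %| 1)%Z by apply/dvdzP; exists R`_(size u).-1; rewrite mulrC -E.
by rewrite dvdz1 -eqz_nat abszE => /eqP.
Qed.

End Dedekind.

(** * The quintic, its quotients by linear factors, and the integral elements they yield *)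

Lemma monic_MXaddC (p : {poly int}) (a : int) :
  p \is monic -> p * 'X + a%:P \is monic.
Proof.
move=> pM; rewrite monicE lead_coefDl ?lead_coefMX -?monicE //.
rewrite size_mulX ?monic_neq0 // ltnS (leq_trans (size_polyC_leq1 _)) //.
by rewrite lt0n size_poly_eq0 monic_neq0.
Qed.

Lemma horner_ZtoC_MXaddC (p : {poly int}) (a : int) (x : algC) :
  (ZtoC (p * 'X + a%:P)).[x] = (ZtoC p).[x] * x + a%:~R.
Proof. by rewrite rmorphD rmorphM /= map_polyX map_polyC hornerMXaddC. Qed.

Lemma gpolyE (c d : int) :
  gpoly c d = ((((1 * 'X + c%:P) * 'X + 0%:P) * 'X + 0%:P) * 'X + 0%:P) * 'X + d%:P.
Proof. rewrite /gpoly; ring. Qed.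

Lemma gpoly_monic (c d : int) : gpoly c d \is monic.
Proof. by rewrite gpolyE !monic_MXaddC ?monic1. Qed.

Lemma horner_gpoly (c d r : int) : (gpoly c d).[r] = r ^+ 5 + c * r ^+ 4 + d.
Proof. by rewrite /gpoly !hornerE. Qed.

Lemma deriv_gpoly (c d : int) :
  (gpoly c d)^`() = 5%:P * 'X^4 + 4%:P * c%:P * 'X^3.
Proof.
rewrite /gpoly !derivD !mul_polyC derivZ !derivXn derivC -!mul_polyC /=; ring.
Qed.

(** This is (g - g(r))/(X - r), in which [d] cancels; the Horner form suits [monic_MXaddC] and
    [horner_ZtoC_MXaddC]. *)
Definition gpoly_quot (c r : int) : {poly int} :=
  (((1 * 'X + (r + c)%:P) * 'X + (r * (r + c))%:P) * 'X + (r ^+ 2 * (r + c))%:P)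
    * 'X + (r ^+ 3 * (r + c))%:P.

Lemma gpoly_quotE (c d r : int) :
  gpoly c d = gpoly_quot c r * ('X - r%:P) + (gpoly c d).[r]%:P.
Proof. rewrite horner_gpoly /gpoly /gpoly_quot; ring. Qed.

Lemma gpoly_quot_monic (c r : int) : gpoly_quot c r \is monic.
Proof. by rewrite /gpoly_quot !monic_MXaddC ?monic1. Qed.

Lemma size_gpoly_quot (c d r : int) :
  (size (gpoly_quot c r) < size (gpoly c d))%N.
Proof.
have M := gpoly_quot_monic c r.
have := size_polyC_leq1 (gpoly c d).[r]; have := size_poly_gt0 (gpoly_quot c r).
rewrite monic_neq0 // => s0 s1.
rewrite (gpoly_quotE c d r).
have sM : size (gpoly_quot c r * ('X - r%:P)) = (size (gpoly_quot c r)).+1.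
  by rewrite size_Mmonic ?monicXsubC ?monic_neq0 // size_XsubC addn2.
by rewrite [X in (_ < X)%N]size_polyDl sM // ltnS (leq_trans s1).
Qed.

(* With [y = x - r] and [b = (g(x) - g(r)) / (m y)], one has [b y = - g(r) / m];
   multiplying [m b = y^4 + ... + g'(r)] by [b^4] gives a monic equation for [b]. *)
Lemma gpoly_quot_div_Aint (c d m r : int) (x : algC) :
  root (ZtoC (gpoly c d)) x -> m != 0 ->
  (m %| (gpoly c d)^`().[r])%Z -> (m * m %| (gpoly c d).[r])%Z ->
  (ZtoC (gpoly_quot c r)).[x] / m%:~R \in Aint.
Proof.
move=> gx m0 /dvdzP[h hE] /dvdzP[e eE].
have mC0 : (m%:~R : algC) != 0 by rewrite intr_eq0.
set b := _ / _.
have bm : b * m%:~R = (ZtoC (gpoly_quot c r)).[x] by rewrite divfK.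
(* Taylor coefficients of g at [r]: g(r + y) = y^5 + h4 y^4 + h3 y^3 + h2 y^2 + g'(r) y + g(r). *)
pose h4 := 5 * r + c; pose h3 := 10 * r ^+ 2 + 4 * c * r.
pose h2 := 10 * r ^+ 3 + 6 * c * r ^+ 2.
have by_ : b * (x - r%:~R) = - (m * e)%:~R.
  have := rootP gx; rewrite (gpoly_quotE c d r) eE rmorphD rmorphM rmorphB /=.
  rewrite map_polyX !map_polyC hornerD hornerM hornerXsubC hornerC /= -bm => H.
  apply: (mulIf mC0); apply/eqP; rewrite -subr_eq0 -[X in _ == X]H; apply/eqP; ring.
have hC : h%:~R * m%:~R = 5 * r%:~R ^+ 4 + 4 * c%:~R * r%:~R ^+ 3 :> algC.
  rewrite -intrM -hE deriv_gpoly !hornerE /=; ring.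
pose P : {poly int} := ((((1 * 'X + (- h)%:P) * 'X + (h2 * e)%:P) * 'X
  + (- (h3 * m * e ^+ 2))%:P) * 'X + (h4 * m ^+ 2 * e ^+ 3)%:P) * 'X
  + (- (m ^+ 3 * e ^+ 4))%:P.
apply: (@root_monic_Aint (ZtoC P)); last exact: ZtoC_int.
  have bm' : b * m%:~R = (x - r%:~R) ^+ 4 + h4%:~R * (x - r%:~R) ^+ 3
     + h3%:~R * (x - r%:~R) ^+ 2 + h2%:~R * (x - r%:~R) + h%:~R * m%:~R.
    by rewrite hC bm !horner_ZtoC_MXaddC rmorph1 hornerC /h4 /h3 /h2; ring.
  rewrite /root !horner_ZtoC_MXaddC rmorph1 hornerC; apply/eqP/(mulfI mC0).
  move: h4 h3 h2 bm' {P} => h4 h3 h2 bm'.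
  have me : m%:~R * e%:~R = - (b * (x - r%:~R)) by rewrite by_ opprK intrM.
  transitivity (b ^+ 4 * (b * m%:~R) - h%:~R * m%:~R * b ^+ 4
    + h2%:~R * (m%:~R * e%:~R) * b ^+ 3 - h3%:~R * (m%:~R * e%:~R) ^+ 2 * b ^+ 2
    + h4%:~R * (m%:~R * e%:~R) ^+ 3 * b - (m%:~R * e%:~R) ^+ 4); first by ring.
  by rewrite me bm'; ring.
by apply: monic_map; rewrite /P !monic_MXaddC ?monic1.
Qed.

(** The integral element g1(x)/m must lie in Z[x], although its numerator is monic of degree below
    that of g. *)
Lemma index_divisor (c d m r : int) (x : algC) :
  irreducible_Zx (gpoly c d) -> root (ZtoC (gpoly c d)) x ->
  (forall a, Zadj x a <-> ring_of_integers x a) -> m != 0 ->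
  (m %| (gpoly c d)^`().[r])%Z -> (m * m %| (gpoly c d).[r])%Z -> `|m| = 1.
Proof.
move=> gI gx Hx m0 mg' mg.
apply: (Zadj_monic_div (gpoly c d) (gpoly_monic c d) gI x m (gpoly_quot c r)) => //.
- exact: gpoly_quot_monic.
- exact: size_gpoly_quot.
apply/Hx; split; last exact: gpoly_quot_div_Aint gx m0 mg' mg.
exists (m%:~R^-1 *: ZtoQ (gpoly_quot c r)).
by rewrite map_polyZ /= hornerZ QtoC_ZtoQ mulrC [ratr _]fmorphV /= ratr_int.
Qed.

(** * Fifth powers modulo 5 and 25 *)

Lemma modz5P (d : int) : exists a b : int, d = 5 * a + b /\ b \in [:: 0; 1; 2; 3; 4].
Proof. by exists (d %/ 5)%Z, (d %% 5)%Z; rewrite !inE; lia. Qed.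

Lemma Fermat5 (d : int) : exists w, d ^+ 5 = d + 5 * w.
Proof.
have [a [b [-> bE]]] := modz5P d.
have [w wE] : exists w, b ^+ 5 = b + 5 * w.
  move: bE; rewrite !inE => /or4P[|||/orP[]] /eqP->.
  - by exists 0.
  - by exists 0.
  - by exists 6.
  - by exists 48.
  - by exists 204.
(* The terms after w - a are ((5a + b)^5 - b^5)/5. *)
exists (w - a + 625 * a ^+ 5 + 625 * a ^+ 4 * b + 250 * a ^+ 3 * b ^+ 2
        + 50 * a ^+ 2 * b ^+ 3 + 5 * a * b ^+ 4).
have -> : 5 * a + b + 5 * (w - a + 625 * a ^+ 5 + 625 * a ^+ 4 * b
        + 250 * a ^+ 3 * b ^+ 2 + 50 * a ^+ 2 * b ^+ 3 + 5 * a * b ^+ 4)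
   = (b + 5 * w) + 5 * (625 * a ^+ 5 + 625 * a ^+ 4 * b
        + 250 * a ^+ 3 * b ^+ 2 + 50 * a ^+ 2 * b ^+ 3 + 5 * a * b ^+ 4) by ring.
by rewrite -wE; ring.
Qed.

(** Modulo 25, g(-d) is c + d - d^5. The fifth powers of units are 1, 7, 18, 24, one in each nonzero
    class modulo 5, and c + d is already congruent to d^5 modulo 5. *)
Lemma dvd25_gpoly_opp (c d : int) : (5 %| c)%Z -> ~~ (5 %| d)%Z ->
  (25 %| (gpoly c d).[- d])%Z = (((c + d) %% 25)%Z \in [:: 1; 7; 18; 24]).
Proof.
move=> /dvdzP[k ->]; have [a [b [-> bE]]] := modz5P d => d5.
rewrite horner_gpoly.
have [W ->] : exists W, (- (5 * a + b)) ^+ 5 + k * 5 * (- (5 * a + b)) ^+ 4 + (5 * a + b)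
    = 25 * W + (5 * k * b ^+ 4 + 5 * a + b - b ^+ 5).
  exists (- (125 * a ^+ 5 + 125 * a ^+ 4 * b + 50 * a ^+ 3 * b ^+ 2
        + 10 * a ^+ 2 * b ^+ 3 + a * b ^+ 4)
     + k * (125 * a ^+ 4 + 100 * a ^+ 3 * b + 30 * a ^+ 2 * b ^+ 2 + 4 * a * b ^+ 3)).
  by ring.
move: bE d5; rewrite !inE => /or4P[|||/orP[]] /eqP->; lia.
Qed.

(** * Ideal membership, one prime at a time *)

Lemma squarefree_prime (n : int) (p : nat) :
  squarefree_int n -> prime p -> ~~ (p%:Z ^+ 2 %| n)%Z.
Proof.
move=> nS pP; apply/negP; rewrite expr2 => /nS/eqP.
by rewrite -abszE absz_nat eqz_nat => /eqP p1; rewrite p1 in pP.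
Qed.

Lemma in_ideal_lin (p : int) (g f u k h f' : {poly int}) :
  in_ideal p g f -> f' = u * f + k * g + p%:P * h -> in_ideal p g f'.
Proof.
move=> [k1 [h1 ->]] ->; exists (u * k1 + k), (u * h1 + h); ring.
Qed.

Lemma Euclid_dvdz (p : nat) (a b : int) : prime p ->
  (p %| a * b)%Z = (p %| a)%Z || (p %| b)%Z.
Proof. by move=> pP; rewrite !dvdzE abszM Euclid_dvdM. Qed.

(* Here [r = - 4 c / 5] modulo [p^2] is the nonzero critical point of [g]. *)
Lemma critical_point_simple (c d r : int) (p : nat) :
  prime p -> p != 5%N -> ~~ (p%:Z ^+ 2 %| d)%Z ->
  squarefree_int
    (((5 ^+ 5 * d + 2 ^+ 8 * c ^+ 5) %/ gcdz (5 ^+ 5 * d) (2 ^+ 8 * c ^+ 5))%Z) ->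
  (p%:Z ^+ 2 %| 5 * r + 4 * c)%Z ->
  (p %| (gpoly c d).[r])%Z -> ~~ (p%:Z ^+ 2 %| (gpoly c d).[r])%Z.
Proof.
move=> pP p5 p2d NS rc pg; apply/negP=> p2g; rewrite horner_gpoly in pg p2g.
have pp2 n : (p%:Z ^+ 2 %| n)%Z -> (p %| n)%Z.
  by apply: dvdz_trans; rewrite expr2 dvdz_mulr.
(* If p divides d and g(r), it divides r, or r + c and then r = (5r + 4c) - 4(r + c); so p^2 divides
   d after all. *)
have [pd|pd] := boolP (p %| d)%Z.
  have pr : (p %| r)%Z.
    have : (p %| r ^+ 4 * (r + c))%Z.
      suff -> : r ^+ 4 * (r + c) = r ^+ 5 + c * r ^+ 4 + d - d by rewrite rpredB.
      by ring.
    rewrite Euclid_dvdz // => /orP[|prc].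
      by rewrite dvdzE abszX Euclid_dvdX // => /andP[].
    suff -> : r = 5 * r + 4 * c - 4 * (r + c) by rewrite rpredB ?dvdz_mull // pp2.
    by ring.
  move/negP: p2d; apply.
  suff -> : d = (r ^+ 5 + c * r ^+ 4 + d) - r ^+ 2 * (r ^+ 2 * (r + c)).
    by rewrite rpredB // dvdz_mulr // dvdz_exp2r.
  by ring.
set N := 5 ^+ 5 * d + _ in NS; set G := gcdz _ _ in NS.
have p2N : (p%:Z ^+ 2 %| N)%Z.
  (* With s = 5r, 5^5 g(r) = s^5 + 5c s^4 + 5^5 d, which equals [N] at s = -4c; the last factor is
     the quotient of the difference by s + 4c. *)
  suff -> : N = 5 ^+ 5 * (r ^+ 5 + c * r ^+ 4 + d) - (5 * r + 4 * c) *
     ((5 * r) ^+ 4 + c * (5 * r) ^+ 3 - 4 * c ^+ 2 * (5 * r) ^+ 2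
      + 16 * c ^+ 3 * (5 * r) - 64 * c ^+ 4).
    by apply: rpredB; [exact: dvdz_mull | exact: dvdz_mulr].
  by rewrite /N; ring.
have GN : (G %| N)%Z by rewrite rpredD ?dvdz_gcdl ?dvdz_gcdr.
have pG : ~~ (p %| G)%Z.
  apply/negP=> /dvdz_trans/(_ (dvdz_gcdl _ _)); rewrite Euclid_dvdz // (negPf pd) orbF.
  rewrite dvdzE abszX Euclid_dvdX // => /andP[+ _]; rewrite dvdn_prime2 //.
  by apply/negP; exact: p5.
have /negP[] := squarefree_prime _ p NS pP.
have cG : coprimez (p%:Z ^+ 2) G by rewrite coprimez_pexpl // coprimezE /= prime_coprime.
by rewrite -(Gauss_dvdzl _ cG) divzK.
Qed.

Lemma in_ideal_of_Aint (c d : int) (x : algC) (p : nat) (f : {poly int}) :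
  irreducible_Zx (gpoly c d) -> root (ZtoC (gpoly c d)) x ->
  squarefree_int
    (((5 ^+ 5 * d + 2 ^+ 8 * c ^+ 5) %/ gcdz (5 ^+ 5 * d) (2 ^+ 8 * c ^+ 5))%Z) ->
  squarefree_int d ->
  ((5 %| c)%Z -> ~~ (5 %| d)%Z -> ((c + d) %% 25)%Z \notin [:: 1; 7; 18; 24]) ->
  prime p -> (ZtoC f).[x] / p%:~R \in Aint -> in_ideal p (gpoly c d) f.
Proof.
move=> gI gx NS dS cd pP fA.
have p0 : p%:Z != 0 by rewrite eqz_nat -lt0n prime_gt0.
have gM := gpoly_monic c d.
have p2d := squarefree_prime _ p dS pP.
have fg' := Aint_div_mul_deriv _ gM gI x p f p0 gx fA; rewrite deriv_gpoly in fg'.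
have strip rs := in_ideal_div_prod _ gM gI x p rs f pP gx.
have s0 : (p %| (gpoly c d).[0])%Z -> ~~ (p%:Z ^+ 2 %| (gpoly c d).[0])%Z.
  by rewrite horner_gpoly !expr0n /= mulr0 !add0r.
have [p5|p5] := eqVneq p 5%N; last first.
  (* [u] inverts 5 modulo p^2, not just p, because [critical_point_simple] needs p^2 to divide 5r +
     4c. *)
  have [u [v]] := Bezoutz 5 (p%:Z ^+ 2).
  have -> : gcdz 5 (p%:Z ^+ 2) = 1.
    by apply/eqP; rewrite -/(coprimez _ _) coprimez_pexpr // coprimezE /= prime_coprime // dvdn_prime2 // eq_sym.
  move=> uv; pose r := - 4 * c * u.
  apply: (strip [:: r; 0; 0; 0]) => // [s|].
    rewrite !inE => /or4P[] /eqP-> //.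
    apply: critical_point_simple => //; apply/dvdzP; exists (4 * c * v).
    by rewrite -mulrA (canRL (addKr _) uv) /r; ring.
  apply: (in_ideal_lin _ _ _ u%:P 0 (f * v%:P * p%:Z%:P * 'X^4) _ fg').
  have uvP : u%:P * 5%:P + v%:P * p%:Z%:P ^+ 2 = 1 :> {poly int}.
    by rewrite -polyC_exp -!polyCM -polyCD uv.
  rewrite !big_cons big_nil /r.
  transitivity (f * ((u%:P * 5%:P + v%:P * p%:Z%:P ^+ 2) * 'X + (4 * c * u)%:P) * 'X^3).
    by rewrite uvP; ring.
  by ring.
subst p; have [c5|c5] := boolP (5 %| c)%Z; last first.
  (* Here g' is 4c X^3 modulo 5 with 4c invertible, so only the root 0 is to be stripped. *)
  have [u [v]] := Bezoutz (4 * c) 5.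
  have -> : gcdz (4 * c) 5 = 1.
    apply/eqP; rewrite gcdzC -/(coprimez _ _) coprimezE prime_coprime //.
    by rewrite -dvdzE Euclid_dvdz.
  move=> uv; apply: (strip [:: 0; 0; 0]) => // [s|].
    by rewrite !inE => /or3P[] /eqP->.
  apply: (in_ideal_lin _ _ _ u%:P 0 (f * (v%:P * 'X^3 - u%:P * 'X^4)) _ fg').
  have uvP : u%:P * (4 * c)%:P + v%:P * 5%:P = 1 :> {poly int}.
    by rewrite -!polyCM -polyCD uv.
  rewrite !big_cons big_nil.
  transitivity (f * ((u%:P * (4 * c)%:P + v%:P * 5%:P) * 'X^3)).
    by rewrite uvP; ring.
  by ring.
have /dvdzP[k kE] := c5; have [w wE] := Fermat5 d.
(* Modulo 5, g is X^5 + d = (X + d)^5 by Fermat, so f (X + d)^5 lies in (5, g) for every f. *)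
apply: (strip (nseq 5 (- d))) => // [s|].
  rewrite mem_nseq /= => /eqP-> _.
  have [d5|d5] := boolP (5 %| d)%Z.
    apply: contra p2d; rewrite horner_gpoly => H.
    suff -> : d = ((- d) ^+ 5 + c * (- d) ^+ 4 + d) - d ^+ 2 * (c * d ^+ 2 - d ^+ 3).
      by rewrite rpredB // dvdz_mulr // dvdz_exp2r.
    by ring.
  rewrite -[5%:Z ^+ 2]/(25 : int) dvd25_gpoly_opp //; exact: cd.
(* The cofactor of [f] is ((X + d)^5 - g)/5, with d^5 = d + 5w and c = 5k. *)
exists f, (f * (d%:P * 'X^4 + 2%:P * d%:P ^+ 2 * 'X^3 + 2%:P * d%:P ^+ 3 * 'X^2
  + d%:P ^+ 4 * 'X + w%:P - k%:P * 'X^4)).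
have wP : d%:P ^+ 5 = d%:P + 5%:P * w%:P :> {poly int}.
  by rewrite -polyC_exp wE polyCD polyCM.
rewrite /= !big_cons big_nil /gpoly kE.
transitivity (f * ('X^5 + 5%:P * (d%:P * 'X^4 + 2%:P * d%:P ^+ 2 * 'X^3
  + 2%:P * d%:P ^+ 3 * 'X^2 + d%:P ^+ 4 * 'X) + d%:P ^+ 5)); first by ring.
by rewrite wP; ring.
Qed.

Theorem theorem3p3 (c d : int) (theta : algC) :
  irreducible_Zx (gpoly c d) ->
  root (map_poly intr (gpoly c d)) theta ->
  squarefree_int
    (((5 ^+ 5 * d + 2 ^+ 8 * c ^+ 5) %/ gcdz (5 ^+ 5 * d) (2 ^+ 8 * c ^+ 5))%Z) ->
  ((forall a : algC, Zadj theta a <-> ring_of_integers theta a) <->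
   (squarefree_int d /\
    ((5 %| c)%Z -> ~~ (5 %| d)%Z -> ((c + d) %% 25)%Z \notin [:: 1; 7; 18; 24]))).
Proof.
move=> gI gx NS; split=> [Hx|[dS cd] a].
  have idx m r := index_divisor c d m r theta gI gx Hx.
  split=> [m md|c5 d5].
    have m0 : m != 0.
      (* If d = 0, then g = X^4 (X + c) is reducible. *)
      apply/negP=> /eqP m0; move: md; rewrite m0 mulr0 dvd0z => /eqP d0.
      have [_ [_ /(_ 'X^4 ('X + c%:P))[]]] := gI.
      - by rewrite /gpoly d0; ring.
      - by rewrite poly_unitE size_polyXn.
      - by rewrite poly_unitE size_XaddC.
    apply: (idx m 0) => //; first by rewrite deriv_gpoly !hornerE /= ?mulr0 ?addr0 dvdz0.
    by rewrite horner_gpoly !expr0n /= mulr0 !add0r.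
  apply/negP; rewrite -dvd25_gpoly_opp // => g25.
  (* The absurd equality follows from m = 5 and r = -d, since 5 | c makes g'(-d) = 5 d^4 - 4c d^3 a
     multiple of 5. *)
  have // : `|5%:Z| = 1.
  apply: (idx 5%:Z (- d)) => //.
  rewrite deriv_gpoly; have /dvdzP[k ->] := c5; apply/dvdzP.
  exists (d ^+ 4 - 4 * k * d ^+ 3); rewrite !hornerE /=; ring.
split=> [[f fE]|].
  split; first by exists (ZtoQ f); rewrite QtoC_ZtoQ.
  rewrite fE; apply: horner_ZtoC_Aint; exact: root_monicZ_Aint (gpoly_monic c d) _ gx.
apply: (Zadj_of_in_ideal _ (gpoly_monic c d) _ gx) => p f.
exact: in_ideal_of_Aint.
Qed.
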